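(* Let $\mathcal{H}$ be a complex Hilbert space, let $A\in\mathbb{B}(\mathcal{H})$ be a positive operator, and let $\mathbb{A}=\begin{bmatrix} A & 0\\ 0 & A\end{bmatrix}$ on $\mathcal{H}\oplus\mathcal{H}$. Let $T,S,X, Y\in\mathbb{B}_{A}(\mathcal{H})$. Then $$w^2_{\mathbb{A}}\left(\begin{bmatrix} T & X \\ Y & S \end{bmatrix}\right) \leq w^2_{\mathbb{A}}\left(\begin{bmatrix} 0 & X \\ Y & 0 \end{bmatrix}\right) + w_{\mathbb{A}}\left(\begin{bmatrix} 0 & XS \\ YT & 0 \end{bmatrix}\right) + \max\big\{w^2_{A}(T), w^2_{A}(S)\big\} + \frac{1}{2}\max\Big\{\big\|T^{\sharp_A}T + XX^{\sharp_A}\big\|_{A},\ \big\|S^{\sharp_A}S + YY^{\sharp_A}\big\|_{A}\Big\}.$$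
   Context: $\mathbb{B}(\mathcal{H})$ is the algebra of bounded linear operators on the complex Hilbert space $\mathcal{H}$. A positive operator $A$ (i.e. $\langle Ax,x\rangle\ge 0$ for all $x$) induces the semi-inner product $\langle x,y\rangle_A=\langle Ax,y\rangle$ and the seminorm $\|x\|_A=\sqrt{\langle x,x\rangle_A}$. $\mathbb{B}_A(\mathcal{H})=\{T\in\mathbb{B}(\mathcal{H}): \mathcal{R}(T^*A)\subseteq\mathcal{R}(A)\}$, where $\mathcal{R}(\cdot)$ denotes the range; equivalently, it is the set of $T$ for which some $R\in\mathbb{B}(\mathcal{H})$ satisfies $AR=T^*A$. For $T\in\mathbb{B}_A(\mathcal{H})$, $T^{\sharp_A}$ denotes the distinguished $A$-adjoint of $T$: the unique operator in $\mathbb{B}(\mathcal{H})$ with $AT^{\sharp_A}=T^*A$ and $\mathcal{R}(T^{\sharp_A})\subseteq\overline{\mathcal{R}(A)}$. $\mathbb{B}_{A^{1/2}}(\mathcal{H})=\{T\in\mathbb{B}(\mathcal{H}): \exists c>0,\ \|Tx\|_A\le c\|x\|_A\ \forall x\in\mathcal{H}\}$, which contains $\mathbb{B}_A(\mathcal{H})$. For $T\in\mathbb{B}_{A^{1/2}}(\mathcal{H})$ the $A$-operator seminorm is $\|T\|_A=\sup\{\|Tx\|_A: x\in\mathcal{H},\ \|x\|_A=1\}$ and the $A$-numerical radius is $w_A(T)=\sup\{|\langle Tx,x\rangle_A|: x\in\mathcal{H},\ \|x\|_A=1\}$. The same definitions with $\mathcal{H}\oplus\mathcal{H}$ and $\mathbb{A}$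 in place of $\mathcal{H}$ and $A$ give $\langle\cdot,\cdot\rangle_{\mathbb{A}}$, $\|\cdot\|_{\mathbb{A}}$ and $w_{\mathbb{A}}(\cdot)$, where $\langle x,y\rangle_{\mathbb{A}}=\langle x_1,y_1\rangle_A+\langle x_2,y_2\rangle_A$ for $x=(x_1,x_2)$, $y=(y_1,y_2)$. $2\times2$ block matrices of operators on $\mathcal{H}$ act on $\mathcal{H}\oplus\mathcal{H}$ in the usual way. $w^2_{\mathbb{A}}(\cdot)$ and $w^2_A(\cdot)$ mean $(w_{\mathbb{A}}(\cdot))^2$ and $(w_A(\cdot))^2$. *)

(* Defs.v *)
From HB Require Import structures.
From mathcomp Require Import all_boot all_order all_algebra.
From mathcomp Require Import sesquilinear complex.
From mathcomp Require Import ring.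
From mathcomp Require Import boolp classical_sets reals topology normedtype.

Set Implicit Arguments.
Unset Strict Implicit.
Unset Printing Implicit Defensive.

Import Order.TTheory GRing.Theory Num.Theory.
Import numFieldNormedType.Exports.

Local Open Scope classical_set_scope.
Local Open Scope ring_scope.

HB.mixin Record isHilbert (R : realType) H & CompleteNormedModule R[i] H := {
  hdot : H -> H -> R[i] ;
  hdot_scalarl : forall y, scalar (hdot^~ y) ;
  hdotC : forall x y, hdot x y = (hdot y x)^* ;
  hdot_norm : forall x, hdot x x = `|x| ^+ 2
}.

#[short(type="hilbertType")]
HB.structure Definition Hilbert (R : realType) :=
  {H of CompleteNormedModule R[i] H & isHilbert R H}.

Arguments hdot {R H} : rename.

Section hdot_dot.
Variables (R : realType) (H : hilbertType R).

Lemma hdot_bilinear :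
  bilinear_for *%R (Num.conj \; *%R) (hdot : H -> H -> R[i]).
Proof.
split=> [y|x]; first exact: hdot_scalarl.
move=> a u v /=; rewrite [LHS]hdotC hdot_scalarl rmorphD rmorphM /=.
by rewrite -(hdotC x u) -(hdotC x v).
Qed.

HB.instance Definition _ :=
  bilinear_isBilinear.Build R[i] H H R[i] *%R (Num.conj \; *%R) hdot
    hdot_bilinear.

Lemma hdot_hermitian (x y : H) : hdot x y = (-1) ^+ false * (hdot y x)^*.
Proof. by rewrite mul1r; exact: hdotC. Qed.

HB.instance Definition _ :=
  isHermitianSesquilinear.Build R[i] H false Num.conj hdot hdot_hermitian.

Lemma hdot_gt0 (x : H) : x != 0 -> 0 < hdot x x.
Proof. by move=> x0; rewrite hdot_norm exprn_gt0 ?normr_gt0. Qed.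

HB.instance Definition _ := isDotProduct.Build R[i] H hdot hdot_gt0.

End hdot_dot.

Lemma minkowski2 (C : numClosedFieldType) (a b c d : C) :
  0 <= a -> 0 <= b -> 0 <= c -> 0 <= d ->
  sqrtC ((a + c) ^+ 2 + (b + d) ^+ 2) <=
  sqrtC (a ^+ 2 + b ^+ 2) + sqrtC (c ^+ 2 + d ^+ 2).
Proof.
move=> a0 b0 c0 d0; set p := sqrtC (a ^+ 2 + _); set q := sqrtC (c ^+ 2 + _).
have pE : p ^+ 2 = a ^+ 2 + b ^+ 2 by rewrite sqrtCK.
have qE : q ^+ 2 = c ^+ 2 + d ^+ 2 by rewrite sqrtCK.
have p0 : 0 <= p by rewrite sqrtC_ge0 addr_ge0 ?exprn_ge0.
have q0 : 0 <= q by rewrite sqrtC_ge0 addr_ge0 ?exprn_ge0.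
have pq : a * c + b * d <= p * q.
  rewrite -(@ler_pXn2r _ 2)// ?nnegrE ?addr_ge0 ?mulr_ge0//.
  rewrite exprMn pE qE -subr_ge0.
  rewrite [leRHS](_ : _ = (a * d - b * c) ^+ 2); last by ring.
  by rewrite real_exprn_even_ge0// rpredB// rpredM// ger0_real.
rewrite -(@ler_pXn2r _ 2)// ?nnegrE ?sqrtC_ge0;
  [|by rewrite addr_ge0 ?exprn_ge0 ?addr_ge0|by rewrite addr_ge0].
rewrite sqrtCK (sqrrD p) pE qE -subr_ge0.
rewrite [leRHS](_ : _ = (p * q - (a * c + b * d)) *+ 2); last by ring.
by rewrite mulrn_wge0// subr_ge0.
Qed.

(* The Hilbert direct sum; the product type itself carries the max norm. *)
Definition hsum (R : realType) (H K : hilbertType R) : Type := (H * K)%type.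

Section hsum_hilbert.
Variables (R : realType) (H K : hilbertType R).

HB.instance Definition _ := GRing.Lmodule.copy (hsum H K) (H * K)%type.

Definition hsum_dot (x y : hsum H K) : R[i] := hdot x.1 y.1 + hdot x.2 y.2.

Lemma hsum_dot_bilinear : bilinear_for *%R (Num.conj \; *%R) hsum_dot.
Proof.
split=> [y|x] a u v; rewrite /hsum_dot /=.
  by rewrite !linearDl !linearZl /= mulrDr addrACA.
by rewrite !linearDr !linearZr /= mulrDr addrACA.
Qed.

HB.instance Definition _ :=
  bilinear_isBilinear.Build R[i] (hsum H K) (hsum H K) R[i]
    *%R (Num.conj \; *%R) hsum_dot hsum_dot_bilinear.

Lemma hsum_dot_hermitian (x y : hsum H K) :
  hsum_dot x y = (-1) ^+ false * (hsum_dot y x)^*.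
Proof. by rewrite mul1r /hsum_dot rmorphD /= -!hdotC. Qed.

HB.instance Definition _ :=
  isHermitianSesquilinear.Build R[i] (hsum H K) false Num.conj hsum_dot
    hsum_dot_hermitian.

Lemma hsum_dot_gt0 (x : hsum H K) : x != 0 -> 0 < hsum_dot x x.
Proof.
case: x => x y; rewrite /hsum_dot !hdot_norm /= => xy0.
rewrite lt_neqAle addr_ge0 ?exprn_ge0// andbT eq_sym.
rewrite paddr_eq0 ?exprn_ge0// !expf_eq0 /= !normr_eq0.
by apply: contra xy0 => /andP[/eqP-> /eqP->].
Qed.

HB.instance Definition _ :=
  isDotProduct.Build R[i] (hsum H K) hsum_dot hsum_dot_gt0.

Definition hsum_norm (x : hsum H K) : R[i] := sqrtC (hsum_dot x x).

Lemma hsum_ler_normD x y : hsum_norm (x + y) <= hsum_norm x + hsum_norm y.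
Proof.
rewrite /hsum_norm /hsum_dot !hdot_norm /=.
apply: le_trans (minkowski2 _ _ _ _) => //.
rewrite ler_sqrtC ?qualifE/= ?addr_ge0 ?exprn_ge0 ?addr_ge0//.
by rewrite lerD// ler_pXn2r ?nnegrE ?addr_ge0// ler_normD.
Qed.

Lemma hsum_normrZ (l : R[i]) x : hsum_norm (l *: x) = `|l| * hsum_norm x.
Proof.
rewrite /hsum_norm linearZl linearZr /= mulrA -normCK.
by rewrite rootCMl ?exprn_ge0// exprCK.
Qed.

Lemma hsum_normr0_eq0 x : hsum_norm x = 0 -> x = 0.
Proof.
move=> /eqP; rewrite /hsum_norm rootC_eq0// => /eqP x0.
by apply/eqP; apply: contraT => /hsum_dot_gt0; rewrite x0 ltxx.
Qed.

HB.instance Definition _ :=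
  Lmodule_isNormed.Build R[i] (hsum H K)
    hsum_ler_normD hsum_normrZ hsum_normr0_eq0.

Lemma hsum_dot_norm (x : hsum H K) : hsum_dot x x = `|x| ^+ 2.
Proof. by rewrite [in RHS]/Num.norm /= sqrtCK. Qed.

Lemma hsum_norm_fst (x : hsum H K) : `|x.1| <= `|x|.
Proof.
rewrite -(@ler_pXn2r _ 2)// ?nnegrE// -hsum_dot_norm /hsum_dot !hdot_norm.
by rewrite lerDl exprn_ge0.
Qed.

Lemma hsum_norm_snd (x : hsum H K) : `|x.2| <= `|x|.
Proof.
rewrite -(@ler_pXn2r _ 2)// ?nnegrE// -hsum_dot_norm /hsum_dot !hdot_norm.
by rewrite lerDr exprn_ge0.
Qed.

Lemma hsum_norm_le (x : hsum H K) : `|x| <= `|x.1| + `|x.2|.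
Proof.
rewrite -(@ler_pXn2r _ 2)// ?nnegrE ?addr_ge0// -hsum_dot_norm /hsum_dot.
rewrite !hdot_norm sqrrD lerD2r lerDl mulrn_wge0// mulr_ge0//.
Qed.

Lemma hsum_complete (F : set_system (hsum H K)) :
  ProperFilter F -> cauchy F -> cvg F.
Proof.
move=> FF /cauchy_ballP Fc.
have F1c : cauchy ((fun x : hsum H K => x.1) @ F).
  apply/cauchy_ballP => e e0; rewrite near_map2.
  apply: filterS (Fc _ e0) => -[x y] /=.
  rewrite -!ball_normE /=; apply: le_lt_trans.
  exact: (hsum_norm_fst (x - y)).
have F2c : cauchy ((fun x : hsum H K => x.2) @ F).
  apply/cauchy_ballP => e e0; rewrite near_map2.
  apply: filterS (Fc _ e0) => -[x y] /=.
  rewrite -!ball_normE /=; apply: le_lt_trans.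
  exact: (hsum_norm_snd (x - y)).
have /cvg_ex[l1 /= F1l] : cvg ((fun x : hsum H K => x.1) @ F).
  exact: cauchy_cvg F1c.
have /cvg_ex[l2 /= F2l] : cvg ((fun x : hsum H K => x.2) @ F).
  exact: cauchy_cvg F2c.
apply/cvg_ex; exists ((l1, l2) : hsum H K).
apply/cvgrPdist_lt => e e0; have e20 : 0 < e / 2 by rewrite divr_gt0.
near=> x; apply: le_lt_trans (hsum_norm_le _) _; rewrite (splitr e) ltrD//=.
  by near: x; move/cvgrPdist_lt : F1l; exact.
by near: x; move/cvgrPdist_lt : F2l; exact.
Unshelve. all: by end_near. Qed.

HB.instance Definition _ := Uniform_isComplete.Build (hsum H K) hsum_complete.

Lemma hsum_dot_scalarl (y : hsum H K) : scalar (hsum_dot^~ y).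
Proof. by case: hsum_dot_bilinear. Qed.

Lemma hsum_dotC (x y : hsum H K) : hsum_dot x y = (hsum_dot y x)^*.
Proof. by rewrite hsum_dot_hermitian mul1r. Qed.

HB.instance Definition _ := isHilbert.Build R (hsum H K)
  hsum_dot_scalarl hsum_dotC hsum_dot_norm.

End hsum_hilbert.

Section operators.
Variables (R : realType) (H : hilbertType R).
Implicit Types A T : H -> H.

Definition bounded_operator T := linear T /\ continuous T.

(* The order of R[i] makes 0 <= z hold only for real z. *)
Definition positive_operator A := forall x, 0 <= hdot (A x) x.

Definition adjoint T : H -> H :=
  get [set T' | bounded_operator T' /\
                forall x y, hdot (T x) y = hdot x (T' y)].

(* The class B_A(H). *)
Definition A_adjointable A T :=
  bounded_operator T /\ range (adjoint T \o A) `<=` range A.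

(* By Douglas' theorem the operator chosen here exists and is unique as soon as
   A is positive and bounded and A_adjointable A T holds. *)
Definition A_adjoint A T : H -> H :=
  get [set T' | [/\ bounded_operator T', A \o T' = adjoint T \o A &
                    range T' `<=` closure (range A)]].

Definition dotA A (x y : H) : R[i] := hdot (A x) y.

Definition normA A (x : H) : R := Num.sqrt (complex.Re (dotA A x x)).

(* sup returns 0 on empty and on unbounded sets. The sets below are empty only
   if A = 0, and bounded whenever normA A (T x) <= c * normA A x for some c,
   which holds if A_adjointable A T. *)
Definition opnormA A T : R :=
  sup [set normA A (T x) | x in [set x | normA A x = 1]].

Definition numradA A T : R :=
  sup [set Normc.normc (dotA A (T x) x) | x in [set x | normA A x = 1]].

Definition block T11 T12 T21 T22 (x : hsum H H) : hsum H H :=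
  (T11 x.1 + T12 x.2, T21 x.1 + T22 x.2).

End operators.

(* Main.v *)
(* With D = diag(T, S) and O the off-diagonal part, |<Mx, x>| <= |<Dx, x>| + |<Ox, x>|
   for the block operator M = D + O. In the square of the right-hand side, Buzano's
   inequality bounds the cross term 2 |<Dx, x>| |<x, O^# x>| by
   |Dx| |O^# x| + |<Dx, O^# x>|: here <Dx, O^# x> = <O D x, x>, and AM-GM turns
   |Dx| |O^# x| into half of <(D^# D + O O^#) x, x>, a diagonal operator.

   The suprema are upper bounds, and T^# exists, by Hilbert space theory: orthogonal
   projections, Riesz representation, uniform boundedness, and Douglas' theorem;
   operators with an A-adjoint are A-bounded because the seminorms of the powers of
   T^# T on a vector are log-convex. *)
Require Import Defs.
From HB Require Import structures.
From mathcomp Require Import all_boot all_order all_algebra.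
From mathcomp Require Import sesquilinear complex.
From mathcomp Require Import ring lra.
From mathcomp Require Import boolp classical_sets functions reals topology normedtype.

Set Implicit Arguments.
Unset Strict Implicit.
Unset Printing Implicit Defensive.

Import Order.TTheory GRing.Theory Num.Theory.
Import numFieldNormedType.Exports.

Local Open Scope classical_set_scope.
Local Open Scope ring_scope.

Local Notation Re := complex.Re.
Local Notation normc := Normc.normc.

(** * Complex scalars and their real-valued modulus *)

Section complex_modulus.
Variable R : realType.
Implicit Types z w : R[i].

Lemma normc_ge0 z : 0 <= normc z.
Proof. by case: z => a b; exact: sqrtr_ge0. Qed.

Lemma normr_normc z : `|z| = (normc z)%:C%C.
Proof. by []. Qed.

Lemma Re_le_normc z : Re z <= normc z.
Proof.
have := normc_ge_Re z; rewrite normr_normc lecR.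
by apply: le_trans; exact: ler_norm.
Qed.

Lemma ReJ z : Re (z^*) = Re z.
Proof. by case: z. Qed.

Lemma ReD z w : Re (z + w) = Re z + Re w.
Proof. by case: z; case: w. Qed.

Lemma Re_conjM z : Re (z^* * z) = normc z ^+ 2.
Proof.
case: z => a b; rewrite /= sqr_sqrtr ?addr_ge0 ?sqr_ge0//; ring.
Qed.

Lemma ReM_real (s : R) z : Re (s%:C%C * z) = s * Re z.
Proof. by case: z => a b /=; rewrite mul0r subr0. Qed.

Lemma normc_real (s : R) : normc s%:C%C = `|s|.
Proof. by rewrite /= expr0n /= addr0 sqrtr_sqr. Qed.

Lemma complexr2 : (2 : R)%:C%C = 2 :> R[i].
Proof. exact: rmorph_nat. Qed.

Lemma normc2 : normc (2 : R[i]) = 2 :> R.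
Proof. by rewrite -complexr2 normc_real normr_nat. Qed.

Lemma conj_real (s : R) : (s%:C%C)^* = s%:C%C :> R[i].
Proof. by rewrite /Num.conj /= oppr0. Qed.

Lemma ge0_complexE z : 0 <= z -> z = (Re z)%:C%C.
Proof. by move=> z0; rewrite RRe_real// ger0_real. Qed.

Lemma gt0_complexP z : 0 < z -> exists2 s : R, 0 < s & z = s%:C%C.
Proof.
move=> z0; have zE := ge0_complexE (ltW z0).
by exists (Re z) => //; rewrite -ltcR -zE.
Qed.

End complex_modulus.

(* Minimality of the quadratic s |-> - 2 s a + s^2 a b at 0. *)
Lemma quadratic_min0 (R : realType) (a b : R) : 0 <= a -> 0 <= b ->
  (forall s, 0 <= s -> 2 * s * a <= s ^+ 2 * a * b) -> a = 0.
Proof.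
(* Any positive [s] with [s * b < 2] would do; this one also covers [b = 0]. *)
move=> a0 b0 /(_ (b + 1)^-1).
have b1 : 0 < b + 1 by rewrite ltr_wpDl.
rewrite invr_ge0 (ltW b1) => /(_ isT) h.
apply/eqP; rewrite eq_le a0 andbT.
have : 2 * (b + 1) * a <= a * b.
  move: h; set t := (b + 1)^-1 => h.
  have tb : t * (b + 1) = 1 by rewrite mulVf// gt_eqF.
  have := ler_wpM2r (exprn_ge0 2 (ltW b1)) h.
  rewrite (_ : 2 * t * a * _ = 2 * (t * (b + 1)) * (b + 1) * a); last by ring.
  rewrite (_ : t ^+ 2 * a * b * _ = (t * (b + 1)) ^+ 2 * (a * b)); last by ring.
  by rewrite tb expr1n mulr1 mul1r.
nra.
Qed.

Lemma expr_unbounded (R : realType) (s K : R) : 1 < s -> exists n, K < s ^+ n.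
Proof.
move=> s1; have s10 : 0 < s - 1 by rewrite subr_gt0.
have bernoulli n : 1 + n%:R * (s - 1) <= s ^+ n.
  elim: n => [|n IHn]; first by rewrite mul0r addr0.
  have n0 : 0 <= n%:R * (s - 1) ^+ 2 by rewrite mulr_ge0 ?sqr_ge0.
  have s0 : 0 <= s by lra.
  rewrite exprSr -natr1; apply: le_trans (ler_wpM2r s0 IHn).
  lra.
exists (Num.truncn (K / (s - 1))).+1; apply: lt_le_trans (bernoulli _).
have := truncnS_gt (K / (s - 1)); rewrite ltr_pdivrMr//; lra.
Qed.

Lemma expfV4_small (R : realType) (e : R) : 0 < e ->
  exists n, (4 ^+ n)^-1 < e.
Proof.
move=> e0; have [n ne] := @expr_unbounded R 4 e^-1 (ltac:(lra)).
by exists n; rewrite invf_plt ?posrE ?exprn_gt0.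
Qed.

(** * The semi-inner product of a positive operator, up to Buzano's inequality *)

Section semi_inner_product.
Variables (R : realType) (H : hilbertType R) (A : H -> H).
Hypotheses (linA : linear A) (posA : positive_operator A).
Implicit Types x y z : H.

Local Notation "<[ x , y ]>" := (dotA A x y).
Local Notation nA := (normA A).

Lemma dotA_linearl a x y z : <[a *: x + y, z]> = a * <[x, z]> + <[y, z]>.
Proof. by rewrite /dotA linA linearDl /= linearZl_LR. Qed.

Lemma dotA_linearr a x y z : <[x, a *: y + z]> = a^* * <[x, y]> + <[x, z]>.
Proof. by rewrite /dotA linearDr /= linearZr_LR. Qed.

Lemma dotADl x y z : <[x + y, z]> = <[x, z]> + <[y, z]>.
Proof. by rewrite -[x]scale1r dotA_linearl mul1r scale1r. Qed.

Lemma dotADr x y z : <[x, y + z]> = <[x, y]> + <[x, z]>.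
Proof. by rewrite -[y]scale1r dotA_linearr rmorph1 mul1r scale1r. Qed.

Lemma dotA0l x : <[0, x]> = 0.
Proof. by apply: (addrI <[0, x]>); rewrite -dotADl !addr0. Qed.

Lemma dotA0r x : <[x, 0]> = 0.
Proof. by apply: (addrI <[x, 0]>); rewrite -dotADr !addr0. Qed.

Lemma dotAZl a x y : <[a *: x, y]> = a * <[x, y]>.
Proof. by rewrite -[_ *: _]addr0 dotA_linearl dotA0l addr0. Qed.

Lemma dotAZr a x y : <[x, a *: y]> = a^* * <[x, y]>.
Proof. by rewrite -[_ *: _]addr0 dotA_linearr dotA0r addr0. Qed.

Lemma dotA_real x : <[x, x]> = (Re <[x, x]>)%:C%C.
Proof. exact: ge0_complexE (posA x). Qed.

(** Polarization: positivity makes the form real on the diagonal, and the vanishing imaginary parts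
    at [x + y] and [i x + y] give the two real equations. *)
Lemma dotAC x y : <[x, y]> = <[y, x]>^*.
Proof.
have := dotA_real ('i%C *: x + y); have := dotA_real (x + y).
rewrite !dotADl !dotADr !dotAZl !dotAZr (dotA_real x) (dotA_real y).
case: <[x, y]> => a b; case: <[y, x]> => c d.
rewrite /Num.conj /= => /eqP; rewrite eq_complex /= => /andP[_ /eqP h1] /eqP.
rewrite eq_complex /= => /andP[_ /eqP h2].
apply/eqP; rewrite eq_complex /=; apply/andP; split; apply/eqP; lra.
Qed.

Lemma normA_ge0 x : 0 <= nA x. Proof. exact: sqrtr_ge0. Qed.

Lemma sqr_normA x : nA x ^+ 2 = Re <[x, x]>.
Proof. by rewrite sqr_sqrtr// -ler0c -dotA_real; exact: posA. Qed.

Lemma sqr_normA_dot x : (nA x ^+ 2)%:C%C = <[x, x]>.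
Proof. by rewrite sqr_normA -dotA_real. Qed.

Lemma sqr_normAD c x y :
  nA (x + c *: y) ^+ 2 =
  nA x ^+ 2 + 2 * Re (c^* * <[x, y]>) + normc c ^+ 2 * nA y ^+ 2.
Proof.
rewrite sqr_normA !dotADl !dotADr !dotAZl !dotAZr (dotAC y x).
rewrite -!sqr_normA_dot -(Re_conjM c).
case: c => a b; case: <[x, y]> => u v; rewrite /Num.conj /=; ring.
Qed.

(** Putting the factor [b] into the coefficient turns the expansion into a real quadratic in [s].
    Its nonnegativity gives Cauchy-Schwarz, and its minimality at 0 gives orthogonality of
    projections. *)
Lemma sqr_normA_subZ (s : R) x y (b := <[x, y]>) :
  nA (x - (s%:C%C * b) *: y) ^+ 2 =
  nA x ^+ 2 - 2 * s * normc b ^+ 2 + s ^+ 2 * normc b ^+ 2 * nA y ^+ 2.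
Proof.
rewrite -scaleNr -mulNr sqr_normAD -/b -rmorphN /=.
rewrite rmorphM /= conj_real -mulrA ReM_real Re_conjM.
rewrite Normc.normcM normc_real exprMn real_normK ?num_real//; ring.
Qed.

Lemma cauchy_schwarzA x y : normc <[x, y]> <= nA x * nA y.
Proof.
have [xA yA] := (normA_ge0 x, normA_ge0 y).
rewrite -(@ler_pXn2r _ 2) ?nnegrE ?normc_ge0 ?mulr_ge0// exprMn.
set b := <[x, y]>; set n := normc b ^+ 2.
have n0 : 0 <= n by rewrite exprn_ge0// normc_ge0.
have Q s : 0 <= nA x ^+ 2 - 2 * s * n + s ^+ 2 * n * nA y ^+ 2.
  by rewrite /n -sqr_normA_subZ sqr_ge0.
have [y0|y0] := eqVneq (nA y) 0; last first.
  have yp : 0 < nA y ^+ 2 by rewrite exprn_gt0// lt_def y0.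
  (* The quadratic attains its minimum at this value of [s]. *)
  have := Q (nA y ^+ 2)^-1; set t := (_)^-1.
  have ty : t * nA y ^+ 2 = 1 by rewrite mulVf// gt_eqF.
  rewrite (_ : t ^+ 2 * n * _ = t * n * (t * nA y ^+ 2)); last by ring.
  rewrite ty mulr1 => h.
  have h' : t * n <= nA x ^+ 2 by lra.
  have := ler_wpM2r (ltW yp) h'.
  by rewrite mulrAC ty mul1r.
rewrite y0 expr0n /= mulr0.
have Q' s : 2 * s * n <= nA x ^+ 2 by have := Q s; rewrite y0; lra.
rewrite leNgt; apply/negP => np.
(* When [y] has seminorm 0 the quadratic is affine in [s], so [n > 0] would make it negative for
   large [s]. *)
have := Q' ((nA x ^+ 2 + 1) / n).
rewrite -mulrA mulfVK ?gt_eqF//; have := sqr_ge0 (nA x); lra.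
Qed.

Lemma normAD x y : nA (x + y) <= nA x + nA y.
Proof.
have [xA yA] := (normA_ge0 x, normA_ge0 y).
rewrite -(@ler_pXn2r _ 2) ?nnegrE ?normA_ge0 ?addr_ge0//.
rewrite -{1}[y]scale1r sqr_normAD rmorph1 mul1r Normc.normc1 expr1n mul1r.
have := le_trans (Re_le_normc _) (cauchy_schwarzA x y); nra.
Qed.

Lemma normAZ c x : nA (c *: x) = normc c * nA x.
Proof.
apply/eqP; rewrite -(@eqrXn2 _ 2) ?normA_ge0 ?mulr_ge0 ?normc_ge0 ?normA_ge0//.
rewrite sqr_normA dotAZl dotAZr -sqr_normA_dot exprMn -Re_conjM.
by apply/eqP; case: c => a b /=; rewrite /Num.conj /=; ring.
Qed.

Lemma normAN x : nA (- x) = nA x.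
Proof. by rewrite -scaleN1r normAZ normcN Normc.normc1 mul1r. Qed.

Lemma normA0 : nA 0 = 0.
Proof. by rewrite /normA dotA0l sqrtr0. Qed.

(* 2 <a, x> x - a is the reflection of a across the line of the unit vector x,
   so it has the same seminorm as a. *)
Lemma buzanoA a b x : nA x = 1 ->
  2 * (normc <[a, x]> * normc <[x, b]>) <= nA a * nA b + normc <[a, b]>.
Proof.
move=> x1; set c := 2 * <[a, x]>.
have reflE : nA (- a + c *: x) = nA a.
  apply/eqP; rewrite -(@eqrXn2 _ 2) ?normA_ge0// sqr_normAD normAN x1.
  rewrite -scaleN1r dotAZl /c.
  rewrite (_ : _^* * _ = (- 2)%:C%C * (<[a, x]>^* * <[a, x]>)); last first.
    by rewrite rmorphM /= rmorph_nat rmorphN /= complexr2; ring.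
  by rewrite ReM_real Re_conjM Normc.normcM normc2; apply/eqP; ring.
have -> : 2 * (normc <[a, x]> * normc <[x, b]>) = normc (c * <[x, b]>).
  by rewrite /c !Normc.normcM normc2 mulrA.
have -> : c * <[x, b]> = <[- a + c *: x, b]> + <[a, b]>.
  by rewrite !dotADl dotAZl addrAC -dotADl addNr dotA0l add0r.
rewrite (le_trans (le_normcD _ _))// lerD2r -reflE.
exact: cauchy_schwarzA.
Qed.

End semi_inner_product.

(** * The Hilbert space norm, as the seminorm of the identity operator *)

Section hilbert_space.
Variables (R : realType) (H : hilbertType R).
Implicit Types (x y z : H) (T : H -> H) (M : set H).

Lemma linear_id : linear (@id H). Proof. by []. Qed.

Lemma positive_id : positive_operator (@id H).
Proof. by move=> x; rewrite hdot_norm exprn_ge0. Qed.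

(* The norm of H takes its values in R[i]; this is its real-valued version. *)
Definition rnorm : H -> R := normA id.

Lemma normr_rnorm x : `|x| = (rnorm x)%:C%C.
Proof.
have x0 : 0 <= `|x| by [].
rewrite (ge0_complexE x0); congr (_%:C)%C.
apply/eqP; rewrite -(@eqrXn2 _ 2) ?sqrtr_ge0//; last first.
  by rewrite -lecR -ge0_complexE.
rewrite (sqr_normA positive_id) /dotA hdot_norm {2}(ge0_complexE x0).
by rewrite -rmorphXn.
Qed.

Lemma rnorm_ge0 x : 0 <= rnorm x. Proof. exact: sqrtr_ge0. Qed.

Lemma rnorm_eq0 x : rnorm x = 0 -> x = 0.
Proof. by move=> x0; apply/eqP; rewrite -normr_eq0 normr_rnorm x0. Qed.

Lemma sqr_rnorm x : (rnorm x ^+ 2)%:C%C = hdot x x.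
Proof. exact: (sqr_normA_dot positive_id). Qed.

Lemma rnormD x y : rnorm (x + y) <= rnorm x + rnorm y.
Proof. exact: (normAD linear_id positive_id). Qed.

Lemma rnormZ c x : rnorm (c *: x) = normc c * rnorm x.
Proof. exact: (normAZ linear_id positive_id). Qed.

Lemma rnormN x : rnorm (- x) = rnorm x.
Proof. exact: (normAN linear_id positive_id). Qed.

Lemma rnorm0 : rnorm 0 = 0.
Proof. exact: (normA0 linear_id). Qed.

Lemma rnormBC x y : rnorm (x - y) = rnorm (y - x).
Proof. by rewrite -rnormN opprB. Qed.

Lemma rnorm_triangle y x z : rnorm (x - z) <= rnorm (x - y) + rnorm (y - z).
Proof. by rewrite -{1}(subrK y x) -addrA rnormD. Qed.

Lemma cauchy_schwarz x y : normc (hdot x y) <= rnorm x * rnorm y.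
Proof. exact: (cauchy_schwarzA linear_id positive_id). Qed.

Lemma hdotDl x y z : hdot (x + y) z = hdot x z + hdot y z.
Proof. exact: linearDl. Qed.

Lemma hdotDr x y z : hdot x (y + z) = hdot x y + hdot x z.
Proof. exact: linearDr. Qed.

Lemma hdotZl c x y : hdot (c *: x) y = c * hdot x y.
Proof. exact: linearZl_LR. Qed.

Lemma hdotZr c x y : hdot x (c *: y) = c^* * hdot x y.
Proof. exact: linearZr_LR. Qed.

Lemma hdotNl x y : hdot (- x) y = - hdot x y.
Proof. exact: linearNl. Qed.

Lemma hdotNr x y : hdot x (- y) = - hdot x y.
Proof. exact: linearNr. Qed.

Lemma hdot_inj x y : (forall z, hdot x z = hdot y z) -> x = y.
Proof.
move=> xy; apply/eqP; rewrite -subr_eq0; apply/eqP/rnorm_eq0.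
apply/eqP; rewrite -sqrf_eq0 -(inj_eq (@complexI R)) sqr_rnorm.
by rewrite hdotDl hdotNl xy subrr.
Qed.

Lemma continuous_rnorm_le T : bounded_operator T ->
  exists2 c, 0 < c & forall x, rnorm (T x) <= c * rnorm x.
Proof.
move=> [lT cT].
pose L : {linear H -> H} := HB.pack T (GRing.isLinear.Build _ _ _ _ T lT).
have /linear_boundedP/pinfty_ex_gt0[r r0 Tr] : bounded_near L (nbhs (0 : H)).
  exact/linear_bounded_continuous.
have [s s0 rE] := gt0_complexP r0; exists s => //.
by move=> x; have := Tr x; rewrite rE !normr_rnorm -rmorphM lecR.
Qed.

Lemma rnorm_le_continuous T c : linear T ->
  (forall x, rnorm (T x) <= c * rnorm x) -> bounded_operator T.
Proof.
move=> lT Tc; split=> //.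
pose L : {linear H -> H} := HB.pack T (GRing.isLinear.Build _ _ _ _ T lT).
apply/(@linear_bounded_continuous _ _ _ L)/bounded_funP => r.
exists (`|c|%:C%C * r) => x xr; rewrite normr_rnorm.
apply: (@le_trans _ _ (`|c|%:C%C * `|x|)); last by rewrite ler_wpM2l ?ler0c.
rewrite normr_rnorm -rmorphM lecR (le_trans (Tc x))//.
by rewrite ler_wpM2r ?rnorm_ge0 ?ler_norm.
Qed.

(** Completeness with an explicit rate: the Cauchy bound [r n] survives as a bound on the distance
    to the limit. *)
Lemma rnorm_complete (x : nat -> H) (r : nat -> R) :
  (forall e, 0 < e -> exists n, r n < e) ->
  (forall n k, rnorm (x (n + k)%N - x n) <= r n) ->
  exists l, forall n, rnorm (x n - l) <= r n.
Proof.
move=> r0 xr.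
have cvx : cvg (x @ \oo).
  apply/cauchy_cvgP/cauchyP => e /gt0_complexP[s s0 ->].
  have [n rn] := r0 s s0.
  exists (x n); change (\forall m \near \oo, ball (x n) s%:C%C (x m)); near=> m.
  rewrite -ball_normE /= -normrN opprB normr_rnorm ltcR.
  rewrite (le_lt_trans _ rn)// -(@subnKC n m); first exact: xr.
  by near: m; exact: nbhs_infty_ge.
exists (lim (x @ \oo)) => n; apply/ler_addgt0Pr => e e0.
have eC : 0 < e%:C%C :> R[i] by rewrite ltcR.
have /cvgrPdist_lt/(_ e%:C%C eC) h := cvx.
near \oo => m.
apply: (le_trans (rnorm_triangle (x m) _ _)); apply: lerD.
  rewrite rnormBC -(@subnKC n m) ?xr//.
  by near: m; exact: nbhs_infty_ge.
rewrite rnormBC -lecR -normr_rnorm ltW//.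
by near: m.
Unshelve. all: by end_near. Qed.

Lemma rnorm_closure M x :
  (forall e, 0 < e -> exists2 m, M m & rnorm (x - m) < e) -> closure M x.
Proof.
move=> xM B /nbhs_ballP[e /= /gt0_complexP[s s0 ->] sB].
have [m Mm xm] := xM s s0.
by exists m; split=> //; apply: sB; rewrite -ball_normE /= normr_rnorm ltcR.
Qed.

End hilbert_space.

(** * Orthogonal projections, Riesz representation, adjoints, uniform boundedness *)

Section hilbert_theory.
Variables (R : realType) (H : hilbertType R).
Implicit Types (x y z : H) (T : H -> H) (M U : set H).

Lemma parallelogram x y :
  rnorm (x - y) ^+ 2 + rnorm (x + y) ^+ 2 = 2 * rnorm x ^+ 2 + 2 * rnorm y ^+ 2.
Proof.
have E c := sqr_normAD (@linear_id R H) (@positive_id R H) c x y.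
rewrite /rnorm -scaleN1r -{2}[y]scale1r !E !rmorphN rmorph1 normcN Normc.normc1.
by rewrite rmorph1 mulN1r mul1r raddfN /=; ring.
Qed.

(** The subspace [M] may fail to be closed, so the projection [y] is only approximated by elements
    of [M]. A minimizing sequence is Cauchy by the parallelogram law, and its limit is a nearest
    point of the closure. *)
Lemma orthogonal_projection M : M 0 ->
  (forall c u v, M u -> M v -> M (c *: u + v)) ->
  forall x, exists y,
    (forall e, 0 < e -> exists2 m, M m & rnorm (y - m) < e) /\
    (forall m, M m -> hdot (x - y) m = 0).
Proof.
move=> M0 Mlin x.
pose D := [set rnorm (x - m) ^+ 2 | m in M]; pose d := inf D.
have Dinf : has_inf D.
  split; first by exists (rnorm (x - 0) ^+ 2), 0.
  by exists 0 => _ [m _ <-]; exact: sqr_ge0.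
have dle m : M m -> d <= rnorm (x - m) ^+ 2.
  by move=> Mm; apply: ge_inf; [exact: Dinf.2 | exists m].
have d0 : 0 <= d.
  by apply: lb_le_inf => [|_ [m _ <-]]; [exact: Dinf.1 | exact: sqr_ge0].
pose r n : R := (4 ^+ n)^-1.
have r0 n : 0 < r n by rewrite invr_gt0 exprn_gt0.
have rD n k : r (n + k)%N <= r n.
  by rewrite lef_pV2 ?posrE ?exprn_gt0// ler_weXn2l ?leq_addr// ler1n.
(* The midpoint of two members of [M] is at squared distance at least [d] from [x]; with the excess
   [r n ^+ 2 / 4] the parallelogram law then gives exactly the rate [r n]. *)
have /choice[y yP] : forall n, exists y,
    M y /\ rnorm (x - y) ^+ 2 < d + r n ^+ 2 / 4.
  move=> n; have e0 : 0 < r n ^+ 2 / 4 by rewrite divr_gt0 ?exprn_gt0.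
  by have [_ [m Mm <-] ?] := inf_adherent e0 Dinf; exists m.
have [l yl] : exists l, forall n, rnorm (y n - l) <= r n.
  apply: rnorm_complete => [e e0|n k]; first exact: expfV4_small.
  rewrite -(@ler_pXn2r _ 2) ?nnegrE ?rnorm_ge0 ?(ltW (r0 n))//.
  have [[Mn yn] [Mk yk]] := (yP n, yP (n + k)%N).
  have := parallelogram (x - y n) (x - y (n + k)%N).
  rewrite (_ : x - y n - _ = y (n + k)%N - y n); last first.
    by rewrite opprB [LHS]addrC addrA subrK.
  rewrite (_ : x - y n + _ = 2 *: (x - 2^-1 *: (1 *: y n + y (n + k)%N))); last first.
    rewrite scalerBr scalerA mulfV ?pnatr_eq0// !scale1r scaler_nat mulr2n.
    by rewrite opprD addrACA.
  rewrite rnormZ normc2 exprMn.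
  have Mmid : M (2^-1 *: (1 *: y n + y (n + k)%N)).
    by rewrite -[X in M X]addr0; apply: (Mlin _ _ _ _ M0); exact: Mlin.
  have := dle _ Mmid.
  have : r (n + k)%N ^+ 2 <= r n ^+ 2 by rewrite ler_pXn2r ?nnegrE ?(ltW (r0 _)).
  lra.
pose clM w := forall e, 0 < e -> exists2 m, M m & rnorm (w - m) < e.
have cll : clM l.
  move=> e /expfV4_small[n ne]; exists (y n); first by have [] := yP n.
  by rewrite rnormBC (le_lt_trans (yl n)).
have xl : rnorm (x - l) <= Num.sqrt d.
  apply/ler_addgt0Pr => e e0; have [n ne] := expfV4_small (divr_gt0 e0 (ltr0Sn R 1)).
  have xyn : rnorm (x - y n) <= Num.sqrt d + r n / 2.
    have [_ /ltW xyn] := yP n.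
    rewrite -(@ler_pXn2r _ 2) ?nnegrE ?rnorm_ge0 ?addr_ge0 ?sqrtr_ge0//
      ?divr_ge0 ?(ltW (r0 n))//.
    apply: (le_trans xyn); rewrite sqrrD sqr_sqrtr// expr_div_n.
    have : 0 <= Num.sqrt d * (r n / 2).
      by rewrite mulr_ge0 ?sqrtr_ge0 ?divr_ge0 ?(ltW (r0 n)).
    lra.
  have := rnorm_triangle (y n) x l; have := yl n; rewrite -/(r n) in ne; lra.
have dcl w : clM w -> Num.sqrt d <= rnorm (x - w).
  move=> clw; apply/ler_addgt0Pr => e /clw[m Mm wm].
  have dxm : Num.sqrt d <= rnorm (x - m).
    by rewrite -(ger0_norm (rnorm_ge0 _)) -sqrtr_sqr ler_wsqrtr ?dle.
  have := rnorm_triangle w x m; lra.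
exists l; split=> // m Mm; set b := hdot (x - l) m.
apply/Normc.eq0_normc/eqP; rewrite -sqrf_eq0; apply/eqP.
(* First variation: the nearest point [l] is compared with its competitors [s b m + l] in the
   closure. *)
apply: (@quadratic_min0 _ _ (rnorm m ^+ 2)); rewrite ?sqr_ge0// => s s0.
have clc c : clM (c *: m + l).
  move=> e /cll[m' Mm' lm']; exists (c *: m + m'); first exact: Mlin.
  by rewrite opprD addrACA subrr add0r.
have := le_trans xl (dcl _ (clc (s%:C%C * b))).
move/(lerXn2r 2); rewrite !nnegrE !rnorm_ge0 => /(_ isT isT).
have := sqr_normA_subZ (@linear_id R H) (@positive_id R H) s (x - l) m.
rewrite /= /dotA -/b => E.
by rewrite opprD addrA addrAC /rnorm E; lra.
Qed.

Lemma riesz_representation (f : H -> R[i]) (c : R) : scalar f ->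
  (forall x, normc (f x) <= c * rnorm x) -> exists z, forall x, f x = hdot x z.
Proof.
move=> linf fc.
have fZD a u v : f (a *: u + v) = a * f u + f v by exact: linf.
have f0 : f 0 = 0.
  have := fZD 1 0 0; rewrite scaler0 addr0 mul1r => /(canLR (addrK _)).
  by rewrite subrr.
have fD u v : f (u + v) = f u + f v by rewrite -{1}[u]scale1r fZD mul1r.
have fZ a u : f (a *: u) = a * f u by rewrite -{1}[_ *: u]addr0 fZD f0 addr0.
have fB u v : f (u - v) = f u - f v by rewrite fD -scaleN1r fZ mulN1r.
have [f_eq0|/existsNP[x0 /eqP fx0]] := pselect (forall x, f x = 0).
  by exists 0 => x; rewrite f_eq0 /= linear0r.
have [||y [cly xy]] := @orthogonal_projection [set x | f x = 0] _ _ x0 => //=.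
  by move=> a u v fu fv; rewrite fZD fu fv mulr0 addr0.
(* The kernel is closed: [f] is bounded and [y] is a limit of kernel elements. *)
have fy : f y = 0.
  have c0 : 0 < `|c| + 1 by rewrite ltr_wpDl.
  apply: Normc.eq0_normc; apply/eqP; rewrite eq_le normc_ge0 andbT.
  apply/ler_addgt0Pr => e e0; rewrite add0r.
  have [m /= fm ym] := cly _ (divr_gt0 e0 c0).
  rewrite -[f y]subr0 -fm -fB (le_trans (fc _))//.
  move: ym; rewrite ltr_pdivlMr//; have := rnorm_ge0 (y - m).
  have := ler_norm c; nra.
set w := x0 - y in xy; have fw : f w = f x0 by rewrite fB fy subr0.
have w0 : hdot w w != 0.
  apply: contra fx0 => /eqP ww; rewrite -fw (_ : w = 0) ?f0//.
  apply: rnorm_eq0; apply/eqP.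
  by rewrite -sqrf_eq0 -(inj_eq (@complexI R)) sqr_rnorm ww.
exists ((f w / hdot w w)^* *: w) => x.
(* The vector [f x *: w - f w *: x] lies in the kernel of [f], to which [w] is orthogonal. *)
have E : f x * hdot w w = f w * hdot x w.
  have := xy (f x *: w - f w *: x); rewrite /= fB !fZ mulrC subrr => /(_ erefl).
  rewrite hdotDr hdotNr !hdotZr => /eqP; rewrite subr_eq0 => /eqP wx.
  by rewrite (hdotC w w) (hdotC x w) -[f x]conjCK -[f w]conjCK -!rmorphM /= wx.
by rewrite hdotZr conjCK mulrAC -E mulfK.
Qed.

Lemma hdot_injr x y : (forall z, hdot z x = hdot z y) -> x = y.
Proof. by move=> xy; apply: hdot_inj => z; rewrite hdotC xy -hdotC. Qed.

(** Riesz representation of the functionals [hdot (T x) y] of [x] yields an adjoint, so the [get] in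
    [adjoint] picks a genuine one. *)
Lemma adjointP T : bounded_operator T ->
  bounded_operator (adjoint T) /\
  forall x y, hdot (T x) y = hdot x (adjoint T y).
Proof.
move=> bT; have [c c0 Tc] := continuous_rnorm_le bT; have [linT _] := bT.
apply: (@getPex _ [set T' | bounded_operator T' /\
                forall x y, hdot (T x) y = hdot x (T' y)]).
have /choice[T' T'P] : forall y, exists z, forall x, hdot (T x) y = hdot x z.
  move=> y; apply: (@riesz_representation _ (c * rnorm y)) => [a u v|x].
    by rewrite linT hdotDl hdotZl.
  rewrite (le_trans (cauchy_schwarz _ _))// mulrAC.
  by rewrite ler_wpM2r ?rnorm_ge0.
exists T'; split=> [|x y]; last exact: T'P.
apply: (@rnorm_le_continuous _ _ _ c) => [a u v|x].
  apply: hdot_injr => z.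
  by rewrite -T'P !hdotDr !hdotZr !T'P.
have [/eqP ->|T'x] := boolP (rnorm (T' x) == 0).
  by rewrite mulr_ge0 ?rnorm_ge0// ltW.
have T'x0 : 0 < rnorm (T' x) by rewrite lt_def T'x rnorm_ge0.
rewrite -(ler_pM2l T'x0) -expr2.
apply: (@le_trans _ _ (normc (hdot (T (T' x)) x))).
  by rewrite T'P -sqr_rnorm normc_real ger0_norm// sqr_ge0.
rewrite (le_trans (cauchy_schwarz _ _))// mulrA ler_wpM2r ?rnorm_ge0//.
by rewrite mulrC Tc.
Qed.

(* Gliding hump: a functional <., u> with u large is at least n on a whole ball
   inside any given ball, and nested balls have a common point. *)
Lemma weakly_bounded U :
  (forall x, exists c, forall u, U u -> normc (hdot x u) <= c) ->
  exists c, forall u, U u -> rnorm u <= c.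
Proof.
move=> wU; apply: contrapT => /forallNP unbU.
pose r n : R := (4 ^+ n)^-1.
have r0 n : 0 < r n by rewrite invr_gt0 exprn_gt0.
have rS n : r n = 4 * r n.+1 by rewrite /r exprS invfM mulrA mulfV ?mul1r ?pnatr_eq0.
have step (nx : nat * H) : exists x', rnorm (x' - nx.2) <= r nx.1 / 2 /\
    exists2 u, U u & forall y, rnorm (x' - y) <= r nx.1.+1 ->
      nx.1%:R <= normc (hdot y u).
  case: nx => n x /=.
  (* This threshold makes [r n.+1 * rnorm u] exceed [n]. *)
  have /existsNP[u /not_implyP[Uu /negP]] := unbU (n%:R / r n.+1).
  rewrite -ltNge ltr_pdivrMr// => nu.
  have u0 : 0 < rnorm u.
    by rewrite lt_def rnorm_ge0 andbT; apply: contraTN nu => /eqP->; rewrite mul0r -leNgt.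
  pose s : R := r n / 2 / rnorm u.
  have s0 : 0 < s by rewrite !divr_gt0.
  have su : rnorm (s%:C%C *: u) = r n / 2.
    by rewrite rnormZ normc_real gtr0_norm// divfK ?gt_eqF.
  (* The values of [hdot _ u] at [x + s u] and [x - s u] differ by [r n * rnorm u], that is
     [4 * r n.+1 * rnorm u], so one of them has at least half that modulus. Moving by at most
     [r n.+1] afterwards costs at most [r n.+1 * rnorm u]. *)
  have [x' xx' x'u] : exists2 x', rnorm (x' - x) = r n / 2 &
      2 * r n.+1 * rnorm u <= normc (hdot x' u).
    have [pos|neg] := leP (2 * r n.+1 * rnorm u) (normc (hdot (x + s%:C%C *: u) u)).
      by exists (x + s%:C%C *: u); rewrite // addrAC subrr add0r.
    exists (x - s%:C%C *: u); first by rewrite addrAC subrr add0r rnormN.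
    have := le_normcD (hdot (x + s%:C%C *: u) u) (- hdot (x - s%:C%C *: u) u).
    rewrite normcN -hdotNl -hdotDl opprB (addrC (_ + _)) addrA subrK -mulr2n -scaler_nat.
    rewrite !hdotZl -sqr_rnorm !Normc.normcM normc2 !normc_real (gtr0_norm s0).
    rewrite ger0_norm ?sqr_ge0// (_ : s * rnorm u ^+ 2 = r n / 2 * rnorm u).
      by move: neg; rewrite (rS n); lra.
    by rewrite expr2 mulrA divfK ?gt_eqF.
  exists x'; split; first by rewrite xx'.
  exists u => // y x'y.
  have := le_normcD (hdot y u) (hdot (x' - y) u); rewrite -hdotDl subrKC.
  have := cauchy_schwarz (x' - y) u.
  have := ler_wpM2r (ltW u0) x'y; nra.
have [g gP] := choice step.
pose x := fix x n := if n is n'.+1 then g (n', x n') else 0.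
have xr n k : rnorm (x (n + k)%N - x n) <= r n.
  elim: k n => [|k IHk] n; first by rewrite addn0 subrr rnorm0 ltW.
  rewrite addnS -addSn (le_trans (rnorm_triangle (x n.+1) _ _))//.
  have [+ _] := gP (n, x n); have := IHk n.+1; rewrite /= (rS n).
  have := r0 n.+1; lra.
have [l xl] := rnorm_complete (@expfV4_small R) xr.
have [c cP] := wU l.
(* Stage [n] controls the ball of radius [r n.+1] about [x n.+1], which contains [l]; hence the
   shift to [.+2] in the next line. *)
have [_ [u Uu]] := gP ((Num.truncn c).+1, x (Num.truncn c).+1).
move=> /(_ l (xl (Num.truncn c).+2)); rewrite leNgt => /negP; apply.
by rewrite (le_lt_trans (cP u Uu))// truncnS_gt.
Qed.

End hilbert_theory.

(** For bounded [T] this is membership in the class $\mathbb{B}_{A^{1/2}}(\mathcal{H})$. *)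
Definition A_bounded (R : realType) (H : hilbertType R) (A T : H -> H) :=
  exists2 c, 0 < c & forall x, normA A (T x) <= c * normA A x.

(** * Existence of A-adjoints, and their A-boundedness *)

Section A_adjoints.
Variables (R : realType) (H : hilbertType R) (A : H -> H).
Hypotheses (bA : bounded_operator A) (posA : positive_operator A).
Implicit Types (x y z : H) (T S P : H -> H).

Let linA : linear A. Proof. by case: bA. Qed.

Lemma positive_selfadjoint x y : hdot (A x) y = hdot x (A y).
Proof. by rewrite -/(dotA A x y) (dotAC linA posA) /dotA -hdotC. Qed.

(* Douglas' theorem: project a solution z of A z = T^* A x on the closure of the
   range of A, whose complement is the kernel of A. By uniform boundedness,
   |A T z| <= c |A z|, which bounds T' on the range of A. *)
Lemma A_adjointP T : A_adjointable A T ->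
  bounded_operator (A_adjoint A T) /\
  forall x y, dotA A (T x) y = dotA A x (A_adjoint A T y).
Proof.
move=> [bT rTA]; have [[linT' _] T'P] := adjointP bT; set T' := adjoint T in linT' T'P.
suff : exists T'', [/\ bounded_operator T'', A \o T'' = T' \o A &
                    range T'' `<=` closure (range A)].
  move=> /(@getPex _ [set T'' | [/\ bounded_operator T'', A \o T'' = T' \o A &
                    range T'' `<=` closure (range A)]]) [bT'' AT'' _].
  split=> // x y.
  rewrite /dotA positive_selfadjoint T'P positive_selfadjoint.
  by have /(congr1 (@^~ y)) /= -> := AT''.
pose cl y := forall e : R, 0 < e -> exists2 m, range A m & rnorm (y - m) < e.
have clB c u v : cl u -> cl v -> cl (c *: u + v).
  move=> clu clv e e0.
  have c0 : 0 < normc c + 1 by rewrite ltr_wpDl ?normc_ge0.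
  have [_ [u' _ <-] uu'] := clu _ (divr_gt0 e0 (mulr_gt0 c0 (ltr0Sn R 1))).
  have [_ [v' _ <-] vv'] := clv _ (divr_gt0 e0 (ltr0Sn R 1)).
  exists (A (c *: u' + v')); first by exists (c *: u' + v').
  rewrite linA opprD addrACA -scalerBr (le_lt_trans (rnormD _ _))// rnormZ.
  move: uu'; rewrite ltr_pdivlMr ?mulr_gt0//.
  have := normc_ge0 c; have := rnorm_ge0 (u - A u'); nra.
(* Since [A] is selfadjoint, its kernel is orthogonal to its range: if [A w] were closer to [y] than
   [rnorm y], then [hdot y (y - A w)], which equals [hdot y y], would be too small. *)
have cl0 y : cl y -> A y = 0 -> y = 0.
  move=> cly Ay; apply: rnorm_eq0; apply/eqP; rewrite eq_le rnorm_ge0 andbT leNgt.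
  apply/negP => y0; have [_ [w _ <-] yw] := cly _ y0.
  have : normc (hdot y (y - A w)) < rnorm y ^+ 2.
    by rewrite (le_lt_trans (cauchy_schwarz _ _))// expr2 ltr_pM2l.
  rewrite hdotDr hdotNr -positive_selfadjoint Ay linear0l subr0 -sqr_rnorm.
  by rewrite normc_real ger0_norm ?sqr_ge0// ltxx.
have A0 : A 0 = 0 by have := linA (-1) 0 0; rewrite scaler0 addr0 scaleN1r addNr.
have /choice[S SP] : forall x, exists y, A y = T' (A x) /\ cl y.
  move=> x; have [z _ Az] : range A (T' (A x)) by apply: rTA; exists x.
  have [||y [cly zy]] := @orthogonal_projection _ _ (range A) _ _ z.
  - by exists 0.
  - by move=> c _ _ [u _ <-] [v _ <-]; exists (c *: u + v); rewrite ?linA.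
  exists y; split=> //; rewrite -Az; apply/eqP; rewrite eq_sym -subr_eq0; apply/eqP.
  apply: hdot_inj => w; rewrite linear0l /= -scaleN1r addrC -linA.
  rewrite positive_selfadjoint addrC scaleN1r; apply: zy; by exists w.
(* The defect of linearity is killed by [A] and lies in the closure of the range, so [cl0]
   applies. *)
have linS : linear S.
  move=> c u v; apply/eqP; rewrite -subr_eq0 (addrC (S _)) -scaleN1r; apply/eqP.
  have [[[AS cS] [ASu cSu]] [ASv cSv]] := (SP (c *: u + v), SP u, SP v).
  apply: cl0; first by apply: (clB) => //; exact: clB.
  by rewrite linA linA AS ASu ASv linA linT' scaleN1r addNr.
have SA x z : hdot (S x) (A z) = hdot x (A (T z)).
  by rewrite -positive_selfadjoint (SP x).1 hdotC -T'P -hdotC positive_selfadjoint.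
have [|c cP] := @weakly_bounded _ _ [set A (T z) | z in [set z | rnorm (A z) <= 1]].
  move=> x; exists (rnorm (S x)) => _ [z /= Az <-]; rewrite -SA.
  by rewrite (le_trans (cauchy_schwarz _ _))// ler_piMr ?rnorm_ge0.
have linT : linear T by case: bT.
(* The uniform bound on the set where [rnorm (A z) <= 1] extends by scaling; if [A z = 0], then [SA]
   makes [A (T z)] orthogonal to everything. *)
have AT z : rnorm (A (T z)) <= `|c| * rnorm (A z).
  have [/rnorm_eq0 Az0|] := eqVneq (rnorm (A z)) 0.
    rewrite Az0 rnorm0 mulr0 (_ : A (T z) = 0) ?rnorm0//.
    by apply: hdot_injr => x; rewrite -SA Az0 !linear0r.
  move=> Az; have Az0 : 0 < rnorm (A z) by rewrite lt_def Az rnorm_ge0.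
  pose a : R[i] := (rnorm (A z))^-1%:C%C.
  have na : normc a = (rnorm (A z))^-1 by rewrite normc_real gtr0_norm ?invr_gt0.
  have AZ u : A (a *: u) = a *: A u by rewrite -[a *: u]addr0 linA A0 addr0.
  have TZ : A (T (a *: z)) = a *: A (T z).
    apply: hdot_injr => x; rewrite -SA AZ hdotZr SA hdotZr//.
  have : rnorm (A (T (a *: z))) <= c.
    by apply: cP; exists (a *: z); rewrite //= AZ rnormZ na mulVf.
  rewrite TZ rnormZ na ler_pdivrMl// => h; rewrite (le_trans h)// mulrC.
  by rewrite ler_pM2r// ler_norm.
exists S; split.
- apply: (@rnorm_le_continuous _ _ _ `|c|) => // x.
  rewrite leNgt; apply/negP => cx.
  have Sx0 : 0 < rnorm (S x).
    by apply: le_lt_trans cx; rewrite mulr_ge0 ?rnorm_ge0.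
  set d := rnorm (S x) - `|c| * rnorm x.
  have d0 : 0 < d by rewrite subr_gt0.
  have cx0 : 0 < rnorm (S x) + `|c| * rnorm x.
    by rewrite ltr_wpDr// mulr_ge0 ?rnorm_ge0.
  (* Replacing [S x] by a nearby [A z] in [hdot (S x) (S x)] and applying [SA] and [AT] gives [d *
     rnorm (S x) <= rnorm (S x - A z) * (rnorm (S x) + |c| * rnorm x)]; approximation within [e]
     contradicts this. *)
  pose e := d * rnorm (S x) / (rnorm (S x) + `|c| * rnorm x) .
  have [_ [z _ <-] Sz] := (SP x).2 e (divr_gt0 (mulr_gt0 d0 Sx0) cx0).
  have eE : e * (rnorm (S x) + `|c| * rnorm x) = d * rnorm (S x).
    by rewrite divfK ?gt_eqF.
  have nAz : rnorm (A z) <= rnorm (S x) + rnorm (S x - A z).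
    have := rnorm_triangle (S x) (A z) 0; rewrite !subr0 rnormBC; lra.
  have := le_normcD (hdot (S x) (S x - A z)) (hdot x (A (T z))).
  rewrite -SA -hdotDr subrK -sqr_rnorm normc_real ger0_norm ?sqr_ge0//.
  have := cauchy_schwarz (S x) (S x - A z).
  have := cauchy_schwarz x (A (T z)); rewrite -SA.
  have := ler_wpM2l (rnorm_ge0 x) (AT z).
  have := ler_wpM2l (mulr_ge0 (normr_ge0 c) (rnorm_ge0 x)) nAz.
  have := ltr_pM2r cx0 (rnorm (S x - A z)) e; rewrite Sz eE /d; lra.
- by apply/funext => x /=; rewrite (SP x).1.
- by move=> _ [x _ <-]; apply: rnorm_closure; exact: (SP x).2.
Qed.

(* The seminorms a n of P^n x are log-convex, so that a 1 > c a 0 would make them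
   grow faster than c^n, whereas c bounds the norm of P. *)
Lemma A_selfadjoint_bounded P : bounded_operator P ->
  (forall x y, dotA A (P x) y = dotA A x (P y)) ->
  A_bounded A P.
Proof.
move=> bP sP; have [c c0 Pc] := continuous_rnorm_le bP.
have [k k0 Ak] := continuous_rnorm_le bA.
exists c => // x; pose a n := normA A (iter n P x).
have a_ge0 n : 0 <= a n by exact: normA_ge0.
have log_convex n : a n.+1 ^+ 2 <= a n * a n.+2.
  rewrite /a -(@ger0_norm _ (_ ^+ 2)) ?sqr_ge0// -normc_real (sqr_normA_dot posA).
  by rewrite [in X in normc X]iterS sP; exact: (cauchy_schwarzA linA posA).
have iter_le n : rnorm (iter n P x) <= c ^+ n * rnorm x.
  elim: n => [|n IHn]; first by rewrite mul1r.
  by rewrite exprS -mulrA (le_trans (Pc _))// ler_pM2l.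
have a_le n : a n <= (c ^+ n) * (Num.sqrt k * rnorm x).
  rewrite -(@ler_pXn2r _ 2) ?nnegrE ?a_ge0 ?mulr_ge0 ?sqrtr_ge0 ?rnorm_ge0//
    ?exprn_ge0 ?(ltW c0)//.
  rewrite (sqr_normA posA) mulrCA exprMn sqr_sqrtr ?(ltW k0)//.
  rewrite (le_trans (Re_le_normc _))// (le_trans (cauchy_schwarz _ _))//.
  apply: (@le_trans _ _ (k * rnorm (iter n P x) ^+ 2)).
    by rewrite expr2 mulrA ler_wpM2r ?rnorm_ge0.
  by rewrite ler_pM2l// ler_pXn2r// nnegrE ?mulr_ge0 ?rnorm_ge0 ?exprn_ge0 ?(ltW c0).
rewrite -/(a 1%N) -[normA A x]/(a 0%N) leNgt; apply/negP => a1.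
have a10 : 0 < a 1%N by apply: le_lt_trans a1; rewrite mulr_ge0// ltW.
have a00 : 0 < a 0%N.
  rewrite lt_def a_ge0 andbT; apply: contraTN (log_convex 0%N) => /eqP->.
  by rewrite mul0r -ltNge exprn_gt0.
pose t := a 1%N / a 0%N.
have t0 : 0 < t by rewrite divr_gt0.
(* By log-convexity the ratios of consecutive terms never decrease, so all are at least the first
   one, [t]. *)
have growth n : 0 < a n /\ t * a n <= a n.+1.
  elim: n => [|n [an IHn]]; first by rewrite /t divfK ?gt_eqF.
  have an1 : 0 < a n.+1 by apply: lt_le_trans IHn; rewrite mulr_gt0.
  split=> //; rewrite -(ler_pM2r an) (mulrC (a n.+2)).
  by rewrite (le_trans _ (log_convex n))// expr2 mulrAC ler_pM2r.
have a_ge n : t ^+ n * a 0%N <= a n.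
  elim: n => [|n IHn]; first by rewrite mul1r.
  by rewrite (le_trans _ (growth n).2)// exprS -mulrA ler_pM2l.
have tc1 : 1 < t / c by rewrite ltr_pdivlMr// mul1r ltr_pdivlMr.
have [n] := expr_unbounded (Num.sqrt k * rnorm x / a 0%N) tc1.
rewrite expr_div_n ltr_pdivrMr// mulrAC ltr_pdivlMr ?exprn_gt0// => h.
have := lt_le_trans h (le_trans (a_ge n) (a_le n)).
by rewrite mulrC ltxx.
Qed.

(** The product of the A-adjoint of [T] with [T] is A-selfadjoint, hence A-bounded, and its form at
    [x] is the squared seminorm of [T x]. *)
Lemma A_adjointable_bounded T : A_adjointable A T -> A_bounded A T.
Proof.
move=> aT; have [bT _] := aT; have [bT' TT'] := A_adjointP aT.
set T' := A_adjoint A T in bT' TT'.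
have T'T x y : dotA A (T' x) y = dotA A x (T y).
  by rewrite (dotAC linA posA) -TT' -(dotAC linA posA).
have [|x y|c c0 Pc] := @A_selfadjoint_bounded (T' \o T).
- have [[linT cT] [linT' cT']] := (bT, bT'); split; last first.
    by move=> x; apply: continuous_comp; [exact: cT | exact: cT'].
  by move=> a u v /=; rewrite linT linT'.
- by rewrite /= T'T TT'.
exists (Num.sqrt c) => [|x]; first by rewrite sqrtr_gt0.
rewrite -(@ler_pXn2r _ 2) ?nnegrE ?mulr_ge0 ?sqrtr_ge0//.
rewrite (sqr_normA posA) -T'T exprMn sqr_sqrtr ?(ltW c0)//.
rewrite (le_trans (Re_le_normc _))//.
rewrite (le_trans (cauchy_schwarzA linA posA _ _))// expr2 mulrA.
by rewrite ler_wpM2r ?sqrtr_ge0//; exact: Pc.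
Qed.

(** A bound [c] for [T] passes to its A-adjoint: with [y] the image of [x], the squared seminorm of
    [y] is the form of [T y] with [x], at most [c] times the product of the seminorms of [y] and
    [x]. *)
Lemma A_adjoint_bounded T :
  A_adjointable A T -> A_bounded A (A_adjoint A T).
Proof.
move=> aT; have [_ TT'] := A_adjointP aT.
have [c c0 Tc] := A_adjointable_bounded aT.
exists c => // x; set y := A_adjoint A T x.
have := normA_ge0 A y; rewrite le_eqVlt => /predU1P[<-|y0].
  by rewrite mulr_ge0 ?normA_ge0 ?ltW.
rewrite -(ler_pM2l y0) -expr2 (sqr_normA posA) -TT'.
rewrite (le_trans (Re_le_normc _))//.
rewrite (le_trans (cauchy_schwarzA linA posA _ _))//.
by rewrite mulrA ler_wpM2r ?normA_ge0// mulrC.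
Qed.

End A_adjoints.

(* Also when sup takes its junk value 0. *)
Lemma sup_nonneg (R : realType) (E : set R) :
  (forall x, E x -> 0 <= x) -> 0 <= sup E.
Proof.
move=> E0; have [supE|/sup_out -> //] := pselect (has_sup E).
have [[x Ex] ubE] := supE.
by rewrite (le_trans (E0 x Ex))// ub_le_sup.
Qed.

(** * The numerical radius and the operator seminorm as upper bounds *)

Section A_bounded_operators.
Variables (R : realType) (H : hilbertType R) (A : H -> H).
Hypotheses (linA : linear A) (posA : positive_operator A).
Implicit Types (x : H) (T S : H -> H).

Lemma A_bounded_comp T S : A_bounded A T -> A_bounded A S -> A_bounded A (T \o S).
Proof.
move=> [c c0 Tc] [d d0 Sd]; exists (c * d) => [|x]; first exact: mulr_gt0.
by rewrite (le_trans (Tc _))// -mulrA ler_pM2l.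
Qed.

Lemma A_bounded_add T S : A_bounded A T -> A_bounded A S -> A_bounded A (T \+ S).
Proof.
move=> [c c0 Tc] [d d0 Sd]; exists (c + d) => [|x]; first exact: addr_gt0.
by rewrite mulrDl (le_trans (normAD linA posA _ _))// lerD.
Qed.

Lemma numradA_ge T x : A_bounded A T -> normA A x = 1 ->
  normc (dotA A (T x) x) <= numradA A T.
Proof.
move=> [c c0 Tc] x1; apply: ub_le_sup; last by exists x.
exists c => _ [y /= y1 <-].
rewrite (le_trans (cauchy_schwarzA linA posA _ _))// y1 mulr1.
by rewrite (le_trans (Tc y))// y1 mulr1.
Qed.

Lemma numradA_ge0 T : 0 <= numradA A T.
Proof. by apply: sup_nonneg => _ [x _ <-]; exact: normc_ge0. Qed.

Lemma opnormA_ge0 T : 0 <= opnormA A T.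
Proof. by apply: sup_nonneg => _ [x _ <-]; exact: normA_ge0. Qed.

Lemma opnormA_ge T x : A_bounded A T -> normA A x = 1 ->
  normA A (T x) <= opnormA A T.
Proof.
move=> [c c0 Tc] x1; apply: ub_le_sup; last by exists x.
by exists c => _ [y /= y1 <-]; rewrite (le_trans (Tc y))// y1 mulr1.
Qed.

Lemma normA_scaled_unit x : normA A x != 0 ->
  exists2 u, normA A u = 1 & x = (normA A x)%:C%C *: u.
Proof.
move=> x0; exists ((normA A x)^-1%:C%C *: x).
  by rewrite (normAZ linA posA) normc_real ger0_norm ?invr_ge0 ?normA_ge0// mulVf.
by rewrite scalerA -rmorphM mulfV// rmorph1 scale1r.
Qed.

(** The components of a unit vector of the direct sum are not unit vectors and may have seminorm 0;
    there Cauchy-Schwarz makes the left side vanish. *)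
Lemma dotA_le_homogeneous T K x : linear T ->
  (forall u, normA A u = 1 -> normc (dotA A (T u) u) <= K) ->
  normc (dotA A (T x) x) <= K * normA A x ^+ 2.
Proof.
move=> linT TK; have [x0|/normA_scaled_unit[u u1 ->]] := eqVneq (normA A x) 0.
  by rewrite (le_trans (cauchy_schwarzA linA posA _ _))// x0 expr0n /= !mulr0.
set a := normA A x; have T0 : T 0 = 0.
  by have := linT (-1) 0 0; rewrite scaler0 addr0 scaleN1r addNr.
have -> : T (a%:C%C *: u) = a%:C%C *: T u.
  by rewrite -[a%:C%C *: u]addr0 linT T0 addr0.
rewrite (dotAZl linA) dotAZr (normAZ linA posA) u1 mulr1 conj_real !Normc.normcM.
by rewrite mulrA -expr2 mulrC ler_wpM2r ?sqr_ge0 ?TK.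
Qed.

Lemma dotA_le_numradA T x : linear T -> A_bounded A T ->
  normc (dotA A (T x) x) <= numradA A T * normA A x ^+ 2.
Proof.
by move=> linT bT; apply: dotA_le_homogeneous => // u u1; exact: numradA_ge.
Qed.

Lemma dotA_le_opnormA T x : linear T -> A_bounded A T ->
  normc (dotA A (T x) x) <= opnormA A T * normA A x ^+ 2.
Proof.
move=> linT bT; apply: dotA_le_homogeneous => // u u1.
rewrite (le_trans (cauchy_schwarzA linA posA _ _))// u1 mulr1.
exact: opnormA_ge.
Qed.

End A_bounded_operators.

(** * Block operators on the direct sum *)

Section block_operators.
Variables (R : realType) (H : hilbertType R) (A : H -> H).
Hypotheses (linA : linear A) (posA : positive_operator A).
Implicit Types (T S X Y : H -> H) (x y : hsum H H).

Local Notation Z := (fun _ : H => 0 : H).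
Local Notation AA := (block A Z Z A).

Lemma linear_block T X Y S : linear T -> linear X -> linear Y -> linear S ->
  linear (block T X Y S).
Proof.
move=> lT lX lY lS a u v; rewrite /block /= lT lX lY lS.
by congr pair; rewrite addrACA -scalerDr.
Qed.

Lemma dotA_block x y : dotA AA x y = dotA A x.1 y.1 + dotA A x.2 y.2.
Proof. by rewrite /dotA /block /hdot /= /hsum_dot /= addr0 add0r. Qed.

Lemma linear_blockA : linear AA.
Proof.
have lZ : linear Z by move=> a u v; rewrite scaler0 addr0.
exact: linear_block.
Qed.

Lemma positive_blockA : positive_operator AA.
Proof.
by move=> x; rewrite -/(dotA AA x x) dotA_block addr_ge0 ?posA.
Qed.

Lemma sqr_normA_block x :
  normA AA x ^+ 2 = normA A x.1 ^+ 2 + normA A x.2 ^+ 2.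
Proof.
by rewrite (sqr_normA positive_blockA) !(sqr_normA posA) dotA_block raddfD.
Qed.

Lemma A_bounded_offdiag X Y : A_bounded A X -> A_bounded A Y ->
  A_bounded AA (block Z X Y Z).
Proof.
(* The sum dominates both constants, so the squared seminorms compare component by component. *)
move=> [c c0 Xc] [d d0 Yd]; exists (c + d) => [|x]; first exact: addr_gt0.
have cd0 : 0 <= c + d by rewrite ltW ?addr_gt0.
rewrite -(@ler_pXn2r _ 2) ?nnegrE ?normA_ge0 ?mulr_ge0 ?normA_ge0//.
rewrite exprMn !sqr_normA_block /block /= add0r addr0 mulrDr addrC.
have le1 (k u v : R) : 0 <= k -> k <= c + d -> 0 <= u -> 0 <= v -> u <= k * v ->
    u ^+ 2 <= (c + d) ^+ 2 * v ^+ 2.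
  move=> k0 kcd u0 v0 ukv; rewrite -exprMn ler_pXn2r ?nnegrE ?mulr_ge0//.
  by rewrite (le_trans ukv)// ler_wpM2r.
apply: lerD; [apply: le1 (Yd _)|apply: le1 (Xc _)]; rewrite ?normA_ge0 ?ltW//; lra.
Qed.

End block_operators.

(** Moving [T] and the A-adjoint of [X] across the form turns the left side into the real part of
    the form of one operator at [x], which its operator seminorm bounds. *)
Lemma normA_adjoint_sum (R : realType) (H : hilbertType R) (A T X : H -> H) x :
  bounded_operator A -> positive_operator A ->
  A_adjointable A T -> A_adjointable A X ->
  normA A (T x) ^+ 2 + normA A (A_adjoint A X x) ^+ 2 <=
  opnormA A ((A_adjoint A T \o T) \+ (X \o A_adjoint A X)) * normA A x ^+ 2.
Proof.
move=> bA posA aT aX; have [linA _] := bA.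
have [[[linT _] _] [[linX _] _]] := (aT, aX).
have [[[linT' _] TT'] [[linX' _] XX']] := (A_adjointP bA posA aT, A_adjointP bA posA aX).
set T' := A_adjoint A T in linT' TT' *; set X' := A_adjoint A X in linX' XX' *.
set G := (T' \o T) \+ (X \o X').
have linG : linear G.
  move=> a u v; rewrite /G /= linT linT' linX' linX.
  by rewrite addrACA -scalerDr.
have bG : A_bounded A G.
  by apply: A_bounded_add => //; apply: A_bounded_comp;
    by [exact: A_adjointable_bounded | exact: A_adjoint_bounded].
apply: le_trans (dotA_le_opnormA linA posA x linG bG).
apply: le_trans (Re_le_normc _).
rewrite !(sqr_normA posA) TT' -XX' /G /= (dotADl linA) ReD.
by rewrite (dotAC linA posA (T' _)) ReJ.
Qed.

(** Convexity of the square. It bounds the diagonal part, with [p], [q] the two numerical radii and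
    [s], [t] the squared seminorms of the components of a unit vector. *)
Lemma sqr_convex_max (R : realType) (p q s t v : R) :
  0 <= v -> 0 <= s -> 0 <= t -> s + t = 1 -> v <= p * s + q * t ->
  v ^+ 2 <= Num.max (p ^+ 2) (q ^+ 2).
Proof.
move=> v0 s0 t0 st vpq.
have h : v ^+ 2 <= p ^+ 2 * s + q ^+ 2 * t.
  apply: (@le_trans _ _ ((p * s + q * t) ^+ 2)).
    by rewrite ler_pXn2r ?nnegrE// (le_trans v0).
  have -> : s = 1 - t by lra.
  (* This is the gap in the convexity inequality when [s + t = 1]. *)
  have : 0 <= s * t * (p - q) ^+ 2 by apply: mulr_ge0; [exact: mulr_ge0 | exact: sqr_ge0].
  have -> : s = 1 - t by lra.
  nra.
apply: (le_trans h); rewrite -[leRHS]mulr1 -st mulrDr.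
by apply: lerD; rewrite ler_wpM2r// le_max lexx ?orbT.
Qed.

Theorem theorem2p10 (R : realType) (H : hilbertType R) (A T S X Y : H -> H) :
  bounded_operator A -> positive_operator A ->
  A_adjointable A T -> A_adjointable A S ->
  A_adjointable A X -> A_adjointable A Y ->
  let Z : H -> H := fun=> 0 in
  let AA := block A Z Z A in
  numradA AA (block T X Y S) ^+ 2 <=
    numradA AA (block Z X Y Z) ^+ 2
    + numradA AA (block Z (X \o S) (Y \o T) Z)
    + Num.max (numradA A T ^+ 2) (numradA A S ^+ 2)
    + 2^-1 * Num.max
        (opnormA A ((A_adjoint A T \o T) \+ (X \o A_adjoint A X)))
        (opnormA A ((A_adjoint A S \o S) \+ (Y \o A_adjoint A Y))).
Proof.
move=> bA posA aT aS aX aY; cbv zeta; set Z : H -> H := fun=> 0; set AA := block A Z Z A.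
have [linA _] := bA.
have [[linT _] _] := aT; have [[linS _] _] := aS.
have [bT bS] := (A_adjointable_bounded bA posA aT, A_adjointable_bounded bA posA aS).
have [bX bY] := (A_adjointable_bounded bA posA aX, A_adjointable_bounded bA posA aY).
have [linAA posAA] := (linear_blockA linA, positive_blockA posA).
set wO := numradA AA (block Z X Y Z); set wOD := numradA AA (block Z (X \o S) _ Z).
set m := Num.max (numradA A T ^+ 2) _.
set g1 := opnormA A _; set g2 := opnormA A (_ \+ _); set g := Num.max g1 g2.
set rhs := (X in _ <= X).
have key x : normA AA x = 1 -> normc (dotA AA (block T X Y S x) x) ^+ 2 <= rhs.
  move=> x1; pose s := normA A x.1 ^+ 2; pose t := normA A x.2 ^+ 2.
  have s0 : 0 <= s by exact: sqr_ge0.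
  have t0 : 0 <= t by exact: sqr_ge0.
  have st : s + t = 1 by rewrite -(sqr_normA_block posA) x1 expr1n.
  pose D := block T Z Z S x; pose O := block Z X Y Z x.
  (* The A-adjoint of the off-diagonal part, applied to [x]: taking adjoints exchanges the two
     corners. *)
  pose O' : hsum H H := block Z (A_adjoint A Y) (A_adjoint A X) Z x.
  have DOE : dotA AA (block T X Y S x) x = dotA AA D x + dotA AA O x.
    rewrite !dotA_block /D /O /block /Z /= !addr0 !add0r !(dotADl linA).
    by rewrite [X in _ + X = _]addrC addrACA.
  have OO' : dotA AA O x = dotA AA x O'.
    rewrite !dotA_block /O /O' /block /Z /= !addr0 !add0r addrC.
    by rewrite (A_adjointP bA posA aX).2 (A_adjointP bA posA aY).2.
  have DO' : dotA AA D O' = dotA AA (block Z (X \o S) (Y \o T) Z x) x.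
    rewrite !dotA_block /D /O' /block /Z /= !addr0 !add0r addrC.
    by rewrite (A_adjointP bA posA aX).2 (A_adjointP bA posA aY).2.
  have Dm : normc (dotA AA D x) ^+ 2 <= m.
    apply: (sqr_convex_max _ s0 t0 st); first exact: normc_ge0.
    rewrite dotA_block /D /block /Z /= addr0 add0r (le_trans (le_normcD _ _))//.
    by apply: lerD; exact: dotA_le_numradA.
  have Ow : normc (dotA AA O x) <= wO.
    by apply: numradA_ge => //; exact: A_bounded_offdiag.
  have DO'w : normc (dotA AA D O') <= wOD.
    rewrite DO'; apply: numradA_ge => //.
    by apply: A_bounded_offdiag => //; exact: A_bounded_comp.
  have DO'g : normA AA D ^+ 2 + normA AA O' ^+ 2 <= g.
    rewrite !(sqr_normA_block posA) /D /O' /block /Z /= !addr0 !add0r.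
    have := normA_adjoint_sum x.1 bA posA aT aX.
    have := normA_adjoint_sum x.2 bA posA aS aY.
    rewrite -/g1 -/g2 -/s -/t => h2 h1.
    have g1g : g1 * s <= g * s by rewrite ler_wpM2r// le_max lexx.
    have g2g : g2 * t <= g * t by rewrite ler_wpM2r// le_max lexx orbT.
    have gE : g = g * s + g * t by rewrite -mulrDr st mulr1.
    lra.
  (* Buzano bounds the cross term by a product of seminorms plus [normc (dotA AA D O')]. The product
     is at most half the sum of the squares, by the square of the difference, hence at most
     [g / 2]. *)
  have := buzanoA linAA posAA D O' x1; rewrite -OO'.
  have := sqr_ge0 (normA AA D - normA AA O').
  have : normc (dotA AA (block T X Y S x) x) ^+ 2 <=
      (normc (dotA AA D x) + normc (dotA AA O x)) ^+ 2.
    rewrite ler_pXn2r ?nnegrE ?addr_ge0 ?normc_ge0//.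
    by rewrite DOE le_normcD.
  have : normc (dotA AA O x) ^+ 2 <= wO ^+ 2.
    by rewrite ler_pXn2r ?nnegrE ?normc_ge0// (le_trans _ Ow) ?normc_ge0.
  rewrite /rhs; nra.
have rhs0 : 0 <= rhs.
  have wOD0 : 0 <= wOD by exact: numradA_ge0.
  have g0 : 0 <= g by rewrite le_max opnormA_ge0.
  have m0 : 0 <= m by rewrite le_max sqr_ge0.
  by rewrite /rhs !addr_ge0 ?sqr_ge0 ?mulr_ge0 ?invr_ge0.
(* The supremum runs over unsquared values, so it is compared with the square root of [rhs]. *)
rewrite -[leRHS](sqr_sqrtr rhs0) ler_pXn2r ?nnegrE ?numradA_ge0 ?sqrtr_ge0//.
rewrite /numradA; set E := (X in sup X).
(* Without vectors of seminorm 1 the supremum is the default value 0, and [rhs0] suffices. *)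
have [E0|/set0P neE] := eqVneq E set0; first by rewrite E0 sup0 sqrtr_ge0.
apply: ge_sup => // _ [x /= x1 <-].
rewrite -(@ler_pXn2r _ 2) ?nnegrE ?normc_ge0 ?sqrtr_ge0//.
by rewrite sqr_sqrtr ?key.
Qed.
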